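(* Let $n\ge 1$ and $a\in\mathbb{C}$. The following statements are equivalent for the KMS matrix $J_n(a)$: (a) $W(J_n(a))$ is a circular disc; (b) the boundary $\partial W(J_n(a))$ contains an elliptic arc; (c) $n=2$ and $a\neq 0$.
   Context: For $n\ge 1$ and $a\in\mathbb{C}$, the KMS matrix $J_n(a)$ is the $n\times n$ strictly upper-triangular matrix whose $(i,j)$ entry is $a^{j-i}$ if $i<j$ and $0$ if $i\ge j$. The numerical range of an $n\times n$ complex matrix $A$ is $W(A)=\{\langle Ax,x\rangle: x\in\mathbb{C}^n,\ \|x\|=1\}$, a compact convex subset of $\mathbb{C}$; $\partial W(A)$ is its boundary in $\mathbb{C}$. A circular disc is a closed disc of positive radius (a single point is not a disc). An elliptic arc is a nondegenerate arc of a nondegenerate ellipse (circles included). *)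

(* Defs.v *)
From HB Require Import structures.
From mathcomp Require Import all_boot all_order all_algebra.
From mathcomp Require Import sesquilinear spectral complex.
From mathcomp Require Import all_classical all_reals all_analysis.

Set Implicit Arguments.
Unset Strict Implicit.
Unset Printing Implicit Defensive.

Import Order.TTheory GRing.Theory Num.Theory.
Import numFieldNormedType.Exports.

Local Open Scope classical_set_scope.
Local Open Scope ring_scope.
Local Open Scope complex_scope.

Definition KMS_matrix (R : realType) (n : nat) (a : R[i]) : 'M[R[i]]_n :=
  \matrix_(i < n, j < n) if (i < j)%N then a ^+ (j - i) else 0.

(* [dotmx u v] is the sum of the [u_k * (v_k)^*], but it is only defined on row
   vectors, hence the transpositions. *)
Definition inner (R : realType) (n : nat) (x y : 'cV[R[i]]_n) : R[i] :=
  dotmx x^T y^T.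

(* The library norm [`|x|] on matrices is the max-norm, not this one. *)
Definition norm2 (R : realType) (n : nat) (x : 'cV[R[i]]_n) : R[i] :=
  sqrtC (inner x x).

Definition numerical_range (R : realType) (n : nat) (A : 'M[R[i]]_n) :
    set R[i] :=
  [set inner (A *m x) x | x in [set x : 'cV[R[i]]_n | norm2 x = 1]].

(* The topology of the complex plane is carried by the alias [R[i]^o]. *)
Definition boundary (R : realType) (W : set R[i]^o) : set R[i]^o :=
  closure W `\` interior W.

Definition is_circular_disc (R : realType) (W : set R[i]) : Prop :=
  exists (c : R[i]) (r : R), 0 < r /\ W = [set z | `|z - c| <= r%:C].

(* The ellipse with centre [c], semi-axes [p] and [q], and axes rotated by the
   unimodular number [u]. *)
Definition ellipse_point (R : realType) (c u : R[i]) (p q theta : R) : R[i] :=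
  c + u * (p * cos theta +i* (q * sin theta)).

(* If [t - s >= 2 * pi] the arc is the whole ellipse. *)
Definition is_elliptic_arc (R : realType) (E : set R[i]) : Prop :=
  exists (c u : R[i]) (p q s t : R),
    [/\ `|u| = 1, 0 < p, 0 < q, s < t &
        E = [set ellipse_point c u p q theta | theta in `[s, t]]].

Definition contains_elliptic_arc (R : realType) (S : set R[i]) : Prop :=
  exists E : set R[i], is_elliptic_arc E /\ E `<=` S.

(* Main.v *)
(* A boundary point [P] of the convex set [W(A)] (Toeplitz-Hausdorff)
   lies on a supporting line, with normal [nu] say, so [Re (nu^* P)] is the
   largest eigenvalue of the Hermitian matrix [(nu^* A + nu A^t* ) / 2].  When [P]
   runs through an elliptic arc, [nu] is the normal of the ellipse, and
   [det (z - w A^t* - v A)] vanishes along a curve parameterized by polynomials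
   in [x = e^(i theta)], hence for every complex [x].  As [A] is strictly
   triangular this determinant is [z^n] for [v = 0] and for [w = 0]; comparing
   with the zeros of [v] and [w] on the curve shows that the ellipse is a circle
   of some radius [r] about 0, so the determinant vanishes at [z = r] whenever
   [w v = 1 / 4].

   For the KMS matrix [A (1 - a N) = a N], [N] the nilpotent shift, so the pencil
   is congruent by unimodular matrices to a tridiagonal Toeplitz matrix, up to
   one corner entry.  At [(r + w) (r + v) = 0] it is triangular, which gives
   [|a| = 2 r]; at [(r + w) (r + v) = 1] the three-term recurrence has a double
   characteristic root, and its boundary condition gives [n = 2]. *)
Require Import Defs.
From mathcomp Require Import all_boot all_order all_algebra.
From mathcomp Require Import complex.
From mathcomp Require Import all_classical all_reals all_analysis.
From mathcomp Require Import ring lra.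
From mathcomp Require Import sesquilinear spectral.
Import Order.TTheory GRing.Theory Num.Theory.
Import numFieldNormedType.Exports.
Local Open Scope ring_scope.
Local Open Scope sesquilinear_scope.

(** * Supporting lines of planar convex sets *)

Definition convex2 {R : realType} (K : R -> R -> Prop) :=
  forall x1 y1 x2 y2 l : R, K x1 y1 -> K x2 y2 -> 0 <= l <= 1 ->
  K (l * x1 + (1 - l) * x2) (l * y1 + (1 - l) * y2).

Lemma convex2_oppl {R : realType} (K : R -> R -> Prop) :
  convex2 K -> convex2 (fun x y => K (- x) y).
Proof.
move=> cK x1 y1 x2 y2 l k1 k2 hl; have := cK _ _ _ _ l k1 k2 hl.
by rewrite !mulrN -opprD.
Qed.

Lemma convex2_oppr {R : realType} (K : R -> R -> Prop) :
  convex2 K -> convex2 (fun x y => K x (- y)).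
Proof.
move=> cK x1 y1 x2 y2 l k1 k2 hl; have := cK _ _ _ _ l k1 k2 hl.
by rewrite !mulrN -opprD.
Qed.

Lemma convex2_axis {R : realType} (K : R -> R -> Prop) (xm xp r : R) :
  convex2 K -> K xm 0 -> K xp 0 -> xm < xp -> xm <= r <= xp -> K r 0.
Proof.
move=> cK km kp lt_m /andP[h1 h2].
have d0 : 0 < xp - xm by rewrite subr_gt0.
have := cK _ _ _ _ ((r - xm) / (xp - xm)) kp km.
have -> : (r - xm) / (xp - xm) * xp + (1 - (r - xm) / (xp - xm)) * xm = r.
  by field; rewrite gt_eqF.
rewrite !mulr0 addr0; apply.
by rewrite divr_ge0 ?subr_ge0 ?(ltW lt_m) //= ler_pdivrMr // mul1r lerD2r.
Qed.

(** A point of small height [y] lies on the segment from [(x2, y2)], taken with weight [t = y / y2],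
    to a point [(r, 0)] of the axis. For small [x] and [y] this [r] stays between [xm] and [xp]. *)
Lemma convex2_half_nbhs {R : realType} (K : R -> R -> Prop) (xm xp x2 y2 : R) :
  convex2 K -> K xm 0 -> K xp 0 -> K x2 y2 -> xm < 0 -> 0 < xp -> 0 < y2 ->
  exists2 e : R, 0 < e & forall x y, `|x| < e -> 0 <= y -> y < e -> K x y.
Proof.
move=> cK km kp k2 m0 p0 y0.
pose c := Num.min xp (- xm).
have c0 : 0 < c by rewrite lt_min p0 oppr_gt0.
(* [B] collects the two terms of [|x| + y * (|x2| / y2)], which bounds [|x - t * x2|] by [c / 2];
   dividing by [1 - t >= 1 / 2] then gives [|r| <= c]. *)
pose B := 1 + `|x2| / y2.
have B0 : 0 < B by rewrite ltr_pwDl // divr_ge0 // ltW.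
exists (Num.min (y2 / 2) (c / (2 * B))).
  by rewrite lt_min !divr_gt0 // mulr_gt0.
move=> x y hx hy0; move: hx; rewrite !lt_min => /andP[hx1 hx2] /andP[hy1 hy2].
pose t := y / y2.
have t0 : 0 <= t by rewrite divr_ge0 // ltW.
have t2 : t <= 1 / 2 by rewrite ler_pdivrMr //; lra.
have ut : 0 < 1 - t by lra.
pose r := (x - t * x2) / (1 - t).
have hn : `|x - t * x2| <= c / 2.
  apply: (le_trans (ler_normB _ _)); rewrite normrM (ger0_norm t0).
  have -> : c / 2 = c / (2 * B) + c / (2 * B) * (`|x2| / y2).
    have -> : c / (2 * B) + c / (2 * B) * (`|x2| / y2) = c / (2 * B) * B.
      by rewrite /B; ring.
    by field; rewrite gt_eqF.
  apply: lerD; first exact: ltW.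
  by rewrite /t mulrAC -mulrA ler_wpM2r ?(ltW hy2) // divr_ge0 // ltW.
have hr : xm <= r <= xp.
  have : `|r| <= c.
    rewrite /r normrM normfV (gtr0_norm ut) ler_pdivrMr //.
    apply: (le_trans hn); rewrite ler_wpM2l ?(ltW c0) //; lra.
  rewrite ler_norml => /andP[]; rewrite /c.
  have := ge_min xp xp (- xm); have := ge_min (- xm) xp (- xm).
  rewrite !lexx orbT => h1 h2 h3 h4; apply/andP; split; lra.
have kr := convex2_axis _ _ _ _ cK km kp (lt_trans m0 p0) hr.
have := cK _ _ _ _ t k2 kr.
have -> : t * x2 + (1 - t) * r = x by rewrite /r; field; rewrite gt_eqF.
have -> : t * y2 + (1 - t) * 0 = y by rewrite /t; field; rewrite gt_eqF.
apply; rewrite t0 /=; lra.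
Qed.

(** A segment joining a point above the axis to one below crosses it at a nonnegative abscissa. So
    each quotient [u / v] from below is at most each one from above, and [m] is the supremum of
    those from below. *)
Lemma convex2_separate {R : realType} (K : R -> R -> Prop) (x2 y2 x3 y3 : R) :
  convex2 K -> (forall x, K x 0 -> 0 <= x) ->
  K x2 y2 -> 0 < y2 -> K x3 y3 -> y3 < 0 ->
  exists m, forall x y, K x y -> m * y <= x.
Proof.
move=> cK kpos k2 h2 k3 h3.
have cross u v s w : K u v -> 0 < v -> K s w -> w < 0 -> s / w <= u / v.
  move=> kuv v0 ksw w0.
  have d0 : 0 < v - w by lra.
  have := cK _ _ _ _ (- w / (v - w)) kuv ksw.
  have -> : - w / (v - w) * v + (1 - - w / (v - w)) * w = 0.
    by field; rewrite gt_eqF.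
  have -> : - w / (v - w) * u + (1 - - w / (v - w)) * s
      = (v * s - w * u) / (v - w) by field; rewrite gt_eqF.
  move=> H.
  have /H /kpos : 0 <= - w / (v - w) <= 1.
    by rewrite divr_ge0 ?oppr_ge0 ?(ltW d0) ?(ltW w0) //= ler_pdivrMr // mul1r; lra.
  rewrite pmulr_lge0 ?invr_gt0 // => h.
  rewrite ler_pdivlMr // mulrAC ler_ndivrMr //; lra.
pose S : set R := [set r | exists u v, [/\ K u v, v < 0 & r = u / v]]%classic.
have S0 : (S !=set0)%classic by exists (x3 / y3), x3, y3.
have Sub : has_ubound S.
  by exists (x2 / y2) => _ [u [v [kuv v0 ->]]]; apply: cross.
exists (sup S) => x y kxy.
have [y0|y0|y0] := ltgtP y 0.
- rewrite -ler_ndivrMr //; apply: ub_le_sup => //.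
  by exists x, y.
- rewrite -ler_pdivlMr //; apply: ge_sup => // _ [u [v [kuv v0 ->]]].
  exact: cross.
- by move: kxy; rewrite y0 mulr0 => /kpos.
Qed.

(** If [K] misses an open half-plane bounded by the axis, the axis supports it; if it misses an open
    half of the axis, [convex2_separate] gives the line; otherwise an upper and a lower
    half-neighbourhood of the origin fit together. *)
Lemma convex2_support {R : realType} (K : R -> R -> Prop) : convex2 K ->
  (exists2 m : R * R, m != 0 & forall x y, K x y -> m.1 * x + m.2 * y <= 0) \/
  (exists2 e : R, 0 < e & forall x y, `|x| < e -> `|y| < e -> K x y).
Proof.
move=> cK.
have [[[x2 y2] /= [k2 h2]]|nup] :=
    pselect (exists u : R * R, K u.1 u.2 /\ 0 < u.2); last first.
  left; exists (0, 1) => [|x y k]; first by rewrite xpair_eqE oner_eq0 andbF.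
  rewrite mul0r add0r mul1r leNgt; apply/negP => y0.
  by apply: nup; exists (x, y).
have [[[x3 y3] /= [k3 h3]]|ndn] :=
    pselect (exists u : R * R, K u.1 u.2 /\ u.2 < 0); last first.
  left; exists (0, -1) => [|x y k]; first by rewrite xpair_eqE oppr_eq0 oner_eq0 andbF.
  rewrite mul0r add0r mulN1r oppr_le0 leNgt; apply/negP => y0.
  by apply: ndn; exists (x, y).
have [[xm [km m0]]|nm] := pselect (exists x, K x 0 /\ x < 0); last first.
  left; have [|m Hm] := convex2_separate _ _ _ _ _ cK _ k2 h2 k3 h3.
    by move=> x kx; rewrite leNgt; apply/negP => x0; apply: nm; exists x.
  exists (-1, m) => [|x y /Hm /=]; last lra.
  by rewrite xpair_eqE oppr_eq0 oner_eq0.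
have [[xp [kp p0]]|np] := pselect (exists x, K x 0 /\ 0 < x); last first.
  left; have k2' : K (- - x2) y2 by rewrite opprK.
  have k3' : K (- - x3) y3 by rewrite opprK.
  have [|m Hm] := convex2_separate _ _ _ _ _ (convex2_oppl _ cK) _ k2' h2 k3' h3.
    move=> x kx; rewrite leNgt; apply/negP => x0; apply: np; exists (- x).
    by rewrite oppr_gt0.
  exists (1, m) => [|x y k /=]; first by rewrite xpair_eqE oner_eq0.
  by have := Hm (- x) y; rewrite opprK => /(_ k); lra.
right.
have [e1 e1_gt0 H1] := convex2_half_nbhs _ _ _ _ _ cK km kp k2 m0 p0 h2.
have km' : K xm (- 0) by rewrite oppr0.
have kp' : K xp (- 0) by rewrite oppr0.
have k3' : K x3 (- - y3) by rewrite opprK.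
have h3' : 0 < - y3 by rewrite oppr_gt0.
have [e2 e2_gt0 H2] :=
  convex2_half_nbhs _ _ _ _ _ (convex2_oppr _ cK) km' kp' k3' m0 p0 h3'.
exists (Num.min e1 e2); first by rewrite lt_min e1_gt0.
move=> x y; rewrite !lt_min => /andP[hx1 hx2] /andP[hy1 hy2].
have [y0|y0] := leP 0 y; first by apply: H1 => //; rewrite -(ger0_norm y0).
have := H2 x (- y); rewrite opprK; apply=> //; first by rewrite oppr_ge0 ltW.
by rewrite -(ltr0_norm y0).
Qed.

(** * Convexity of the numerical range *)

(* The library lemmas [linearDl], [linearZl_LR], ... also fire on products in [C];
   these instances are confined to [dotmx]. *)
Lemma dotmxDl {C : numClosedFieldType} {n} (u v w : 'rV[C]_n) :
  dotmx (u + v) w = dotmx u w + dotmx v w.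
Proof. exact: linearDl. Qed.

Lemma dotmxDr {C : numClosedFieldType} {n} (u v w : 'rV[C]_n) :
  dotmx u (v + w) = dotmx u v + dotmx u w.
Proof. exact: linearDr. Qed.

Lemma dotmxZl {C : numClosedFieldType} {n} (a : C) (u v : 'rV[C]_n) :
  dotmx (a *: u) v = a * dotmx u v.
Proof. exact: linearZl_LR. Qed.

Lemma dotmxZr {C : numClosedFieldType} {n} (a : C) (u v : 'rV[C]_n) :
  dotmx u (a *: v) = a^* * dotmx u v.
Proof. exact: linearZr_LR. Qed.

Lemma dotmx_normalize {C : numClosedFieldType} {n} (M : 'M[C]_n) (z : 'rV[C]_n) :
  z != 0 -> exists z', dotmx z' z' = 1 /\
    dotmx (z' *m M) z' = dotmx (z *m M) z / dotmx z z.
Proof.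
move=> z0; have N0 : 0 < dotmx z z by rewrite dnorm_gt0.
pose r := (sqrtC (dotmx z z))^-1.
have rr : r * r^* = (dotmx z z)^-1.
  rewrite /r conj_Creal ?rpredV ?ger0_real ?sqrtC_ge0 ?ltW //.
  by rewrite -expr2 exprVn sqrtCK.
exists (r *: z); split.
  by rewrite dotmxZl dotmxZr mulrA rr mulVf // gt_eqF.
by rewrite -scalemxAl dotmxZl dotmxZr mulrA rr mulrC.
Qed.

Lemma exists_phase {C : numClosedFieldType} (P Q : C) :
  exists w : C, w * w^* = 1 /\ w * P + w^* * Q \is Num.real.
Proof.
pose D := P - Q^*.
suff [w [w1 wD]] : exists w : C, w * w^* = 1 /\ w * D \is Num.real.
  exists w; split => //.
  have -> : w * P + w^* * Q = w * D + (w * Q^* + w^* * Q) by rewrite /D; ring.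
  apply: rpredD => //; apply/CrealP.
  by rewrite rmorphD !rmorphM /= !conjCK addrC.
have [D0|D0] := eqVneq D 0.
  by exists 1; rewrite conjC1 mulr1 D0 mulr0 rpred0.
exists (D^* / `|D|); split.
  rewrite -normCK normrM normfV normr_id norm_conjC divff ?expr1n //.
  by rewrite normr_eq0.
by rewrite mulrAC [D^* * D]mulrC -normCK rpredM ?rpredV ?rpredX ?normr_real.
Qed.

(* After subtracting a scalar and rescaling, the quadratic form takes the values
   1 at x and 0 at y.  A phase on x makes its cross term real, and a real
   combination t x + y of prescribed value solves a quadratic equation with
   positive discriminant. *)
Lemma toeplitz_hausdorff {C : numClosedFieldType} {n} (M : 'M[C]_n)
    (x y : 'rV[C]_n) (l : C) :
  dotmx x x = 1 -> dotmx y y = 1 -> 0 <= l <= 1 ->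
  exists z, dotmx z z = 1 /\
    dotmx (z *m M) z = l * dotmx (x *m M) x + (1 - l) * dotmx (y *m M) y.
Proof.
move=> x1 y1 /andP[l0 l1].
set al := dotmx (x *m M) x; set be := dotmx (y *m M) y.
have [ab|ab] := eqVneq al be.
  by exists x; split=> //; rewrite -/al -ab; ring.
have [->|ln1] := eqVneq l 1; first by exists x; split=> //; rewrite -/al; ring.
have ab0 : al - be != 0 by rewrite subr_eq0.
have lt1 : 0 < 1 - l by rewrite subr_gt0 lt_neqAle ln1.
pose g (u v : 'rV[C]_n) := (dotmx (u *m M) v - be * dotmx u v) / (al - be).
have gxx : g x x = 1 by rewrite /g x1 mulr1 divff.
have gyy : g y y = 0 by rewrite /g y1 mulr1 subrr mul0r.
have [w [w1 wr]] := exists_phase (g x y) (g y x).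
have l_real : l \is Num.real by apply: ger0_real.
have [k kE k_real] : exists2 k, w * dotmx x y + w^* * dotmx y x = 2 * k &
    k \is Num.real.
  exists ((w * dotmx x y + w^* * dotmx y x) / 2).
    by rewrite [RHS]mulrC divfK // pnatr_eq0.
  rewrite rpredM ?rpredV ?rpred_nat //; apply/CrealP.
  rewrite rmorphD !rmorphM /= !conjCK addrC; congr (_ * _ + _ * _).
    by rewrite [RHS]hermC expr0 mul1r.
  by rewrite [RHS]hermC expr0 mul1r.
have [h hE h_real] : exists2 h, w * g x y + w^* * g y x = 2 * h &
    h \is Num.real.
  exists ((w * g x y + w^* * g y x) / 2).
    by rewrite [RHS]mulrC divfK // pnatr_eq0.
  by rewrite rpredM ?rpredV ?rpred_nat.
pose d := h - l * k.
have d_real : d \is Num.real by rewrite rpredB ?rpredM.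
(* For [z = t w x + y] the goal [g z z = l * dotmx z z] reads [(1 - l) t^2 + 2 t d = l]; [s ^+ 2] is
   a quarter of its discriminant. *)
pose s := sqrtC (d ^+ 2 + l * (1 - l)).
have s2 : s ^+ 2 = d ^+ 2 + l * (1 - l) by rewrite sqrtCK.
have s_real : s \is Num.real.
  apply: ger0_real; rewrite sqrtC_ge0 addr_ge0 ?(mulr_ge0 l0 (ltW lt1)) //.
  exact: real_exprn_even_ge0.
pose t := (s - d) / (1 - l).
have t_real : t \is Num.real by rewrite rpredM // ?rpredV rpredB // rpred1.
have tE : (1 - l) * t ^+ 2 + 2 * t * d = l.
  have l10 : 1 - l != 0 by rewrite gt_eqF.
  have -> : (1 - l) * t ^+ 2 + 2 * t * d = (s ^+ 2 - d ^+ 2) / (1 - l).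
    by rewrite /t; field.
  by rewrite s2; field.
clearbody t.
have tC : t^* = t by apply/CrealP.
pose z := (t * w) *: x + y.
have zz : dotmx z z = t ^+ 2 + 2 * t * k + 1.
  rewrite /z dotmxDl !dotmxDr !dotmxZl !dotmxZr x1 y1.
  rewrite rmorphM /= tC.
  have -> : t * w * (t * w^* * 1) + t * w * dotmx x y +
            (t * w^* * dotmx y x + 1) =
    t ^+ 2 * (w * w^*) + t * (w * dotmx x y + w^* * dotmx y x) + 1 by ring.
  by rewrite w1 kE; ring.
have gzz : g z z = t ^+ 2 + 2 * t * h.
  have -> : g z z = t * t^* * (w * w^*) * g x x +
       (t * w * g x y + t^* * w^* * g y x) + g y y.
    rewrite /g /z mulmxDl -scalemxAl !dotmxDl !dotmxDr.
    rewrite !dotmxZl !dotmxZr rmorphM /=.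
    by field.
  have -> : t * w * g x y + t^* * w^* * g y x = t * (2 * h).
    by rewrite -hE tC; ring.
  by rewrite gxx gyy w1 tC; ring.
(* If [z = 0] then [y] is a multiple of [x], and [g y y = 0] forces [t = 0], hence [y = 0], against
   its unit norm. *)
have z0 : z != 0.
  apply/eqP => z0.
  have yE : y = - (t * w) *: x.
    by apply/eqP; rewrite scaleNr -subr_eq0 opprK addrC -/z z0.
  have : g y y = t ^+ 2.
    have -> : g y y = t * t^* * (w * w^*) * g x x.
      rewrite /g yE -scalemxAl !dotmxZl !dotmxZr rmorphN rmorphM /=.
      by field.
    by rewrite gxx w1 tC; ring.
  rewrite gyy => /esym/eqP; rewrite expf_eq0 /= => /eqP t0.
  move: y1; rewrite yE t0 mul0r oppr0 scale0r linear0l => /esym/eqP.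
  by rewrite oner_eq0.
have [z' [z'1 z'E]] := dotmx_normalize M z z0.
exists z'; split=> //; rewrite z'E.
have zz0 : dotmx z z != 0 by rewrite gt_eqF // dnorm_gt0.
have -> : dotmx (z *m M) z = (al - be) * g z z + be * dotmx z z.
  by rewrite /g; field.
apply: (mulIf zz0); rewrite divfK //.
have -> : g z z = l * dotmx z z.
  rewrite gzz zz; apply/eqP; rewrite -subr_eq0; apply/eqP.
  have /eqP := tE; rewrite -subr_eq0 => /eqP <-; rewrite /d; ring.
ring.
Qed.

Lemma hermitian_spectral {C : numClosedFieldType} {n} (H : 'M[C]_n) :
  H \is hermsymmx ->
  H = invmx (spectralmx H) *m diag_mx (spectral_diag H) *m spectralmx H.
Proof.
move=> hH; have hn := hermitian_normalmx hH.
have h := @orthomx_spectralP _ _ H; cbv zeta in h.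
exact (elimT h hn).
Qed.

(* In an orthonormal eigenbasis the form is [sum_i d_i |y_i|^2] with all
   [d_i <= m]; if every [d_i] were [< m] the supremum could not be [m]. *)
Lemma det_sub_sup_eq0 {C : numClosedFieldType} {n} (H : 'M[C]_n) (m : C) :
  H \is hermsymmx ->
  (forall x, dotmx x x = 1 -> dotmx (x *m H) x <= m) ->
  (forall e, 0 < e -> exists2 x, dotmx x x = 1 & m - e < dotmx (x *m H) x) ->
  \det (m%:M - H) = 0.
Proof.
move=> hH Hle Hsup.
set P := spectralmx H; set d := spectral_diag H.
have HE : H = invmx P *m diag_mx d *m P := hermitian_spectral H hH.
have Pu : P \in unitmx by exact: spectral_unit.
have PP : P *m P^t* = 1%:M by apply/unitarymxP/spectral_unitarymx.
have yy (y : 'rV_n) : dotmx (y *m P) (y *m P) = \sum_i `|y 0 i| ^+ 2.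
  rewrite dotmxE trmx_mul map_mxM mulmxA -[y *m P *m _]mulmxA PP mulmx1 mxE.
  by apply: eq_bigr => i _; rewrite !mxE normCK.
have yHy (y : 'rV_n) :
    dotmx (y *m P *m H) (y *m P) = \sum_i d 0 i * `|y 0 i| ^+ 2.
  rewrite dotmxE trmx_mul map_mxM {1}HE !mulmxA mulmxK //.
  rewrite -[_ *m P *m _]mulmxA PP mulmx1 mul_mx_diag mxE.
  by apply: eq_bigr => i _; rewrite !mxE mulrAC -normCK mulrC.
(* The bound is tested at row [i] of [P], a unit eigenvector. *)
have dle i : d 0 i <= m.
  have e1 (F : 'I_n -> C) :
      \sum_j F j * `|(delta_mx 0 i : 'rV[C]_n) 0 j| ^+ 2 = F i.
    rewrite (bigD1 i) //= big1 => [|j ji]; rewrite mxE eqxx /=.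
      by rewrite eqxx normr1 expr1n mulr1 addr0.
    by rewrite (negbTE ji) normr0 expr0n mulr0.
  have := Hle (delta_mx 0 i *m P); rewrite yHy e1; apply.
  by rewrite yy -[RHS](e1 (fun=> 1)); apply: eq_bigr => j _; rewrite mul1r.
apply/eqP/negPn/negP => det0.
have dlt i : 0 < m - d 0 i.
  rewrite subr_gt0 lt_neqAle dle andbT; apply: contra_neq det0 => di.
  have -> : m%:M - H = invmx P *m (m%:M - diag_mx d) *m P.
    by rewrite mulmxBr mulmxBl -HE -scalemx1 -scalemxAr mulmx1 -scalemxAl mulVmx.
  have -> : m%:M - diag_mx d = diag_mx (\row_i (m - d 0 i)).
    by apply/matrixP => j k; rewrite !mxE -mulrnBl; case: eqP => [->|].
  rewrite !det_mulmx det_diag (bigD1 i) //= mxE di subrr mul0r mulr0.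
  by rewrite mul0r.
(* Every gap [m - d 0 i] is at least [s^-1], so the form stays at distance [s^-1] below [m]. *)
pose s := 1 + \sum_i (m - d 0 i)^-1.
have s0 : 0 < s by rewrite ltr_pwDl // sumr_ge0 // => i _; rewrite invr_ge0 ltW.
have [|x x1] := Hsup s^-1; first by rewrite invr_gt0.
have [y xE] : exists y, x = y *m P by exists (x *m invmx P); rewrite mulmxKV.
move: x1; rewrite xE yy yHy => y1.
suff: s^-1 <= m - \sum_i d 0 i * `|y 0 i| ^+ 2.
  by rewrite lerBrDr -lerBrDl => /le_lt_trans h /h; rewrite ltxx.
have -> : m - \sum_i d 0 i * `|y 0 i| ^+ 2
    = \sum_i (m - d 0 i) * `|y 0 i| ^+ 2.
  rewrite -[X in X - _]mulr1 -y1 mulr_sumr -sumrB.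
  by apply: eq_bigr => i _; rewrite mulrBl.
rewrite -[s^-1]mulr1 -y1 mulr_sumr; apply: ler_sum => i _.
apply: ler_wpM2r; first exact: exprn_ge0.
rewrite -[m - _]invrK lef_pV2 ?posrE ?invr_gt0 //.
rewrite /s (bigD1 i) //= addrCA lerDl addr_ge0 // sumr_ge0 // => j _.
by rewrite invr_ge0 ltW.
Qed.

(** * Boundary points and the determinantal pencil *)

(** Balls of [R[i]^o] have radii in [R[i]]; a positive radius is real, so real radii suffice. *)
Lemma interiorP_complex {R : realType} (W : set R[i]^o) (p : R[i]) :
  interior W p <-> exists2 e : R, 0 < e & forall z, `|p - z| < (real_complex _ e) -> W z.
Proof.
split.
  move=> /nbhs_ballP [e /= e0 H].
  have er : real_complex R (complex.Re e) = e by rewrite RRe_real // ger0_real // ltW.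
  exists (complex.Re e); first by rewrite -ltcR er.
  by move=> z; rewrite er => /H.
move=> [e e0 H]; apply/nbhs_ballP; exists (real_complex R e) => /=; first by rewrite ltcR.
by move=> z /H.
Qed.

Lemma closureP_complex {R : realType} (W : set R[i]^o) (p : R[i]) :
  closure W p <-> forall e : R, 0 < e -> exists2 z, W z & `|p - z| < (real_complex _ e).
Proof.
split.
  move=> H e e0; have [|z [Wz pz]] := H (ball (p : R[i]^o) (real_complex R e)).
    by apply: nbhsx_ballx; rewrite ltcR.
  by exists z.
move=> H B /nbhs_ballP [e /= e0 HB].
have er : real_complex R (complex.Re e) = e by rewrite RRe_real // ger0_real // ltW.
have [|z Wz pz] := H (complex.Re e); first by rewrite -ltcR er.
by exists z; split=> //; apply: HB; rewrite /ball /= -er.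
Qed.

Lemma numerical_rangeP {R : realType} {n} (A : 'M[R[i]]_n) (z : R[i]) :
  numerical_range A z <->
  exists x : 'rV[R[i]]_n, dotmx x x = 1 /\ z = dotmx (x *m A^T) x.
Proof.
split.
  move=> [x /= x1 <-]; exists x^T; split; last by rewrite /inner trmx_mul.
  by rewrite -[LHS]sqrtCK; move: x1; rewrite /norm2 /inner => ->; rewrite expr1n.
move=> [x [x1 ->]]; exists x^T => /=; first by rewrite /norm2 /inner trmxK x1 sqrtC1.
by rewrite /inner trmx_mul trmxK.
Qed.

Lemma numerical_range_convex {R : realType} {n} (A : 'M[R[i]]_n) (z1 z2 : R[i]) (l : R) :
  numerical_range A z1 -> numerical_range A z2 -> 0 <= l <= 1 ->
  numerical_range A (real_complex R l * z1 + (1 - real_complex R l) * z2).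
Proof.
move=> /numerical_rangeP[x [x1 ->]] /numerical_rangeP[y [y1 ->]] /andP[l0 l1].
have [|z [z1' zE]] := toeplitz_hausdorff A^T x y (real_complex R l) x1 y1.
  by rewrite ler0c l0 -[1]/(real_complex R 1) lecR.
by apply/numerical_rangeP; exists z.
Qed.

Lemma numerical_range_support {R : realType} {n} (A : 'M[R[i]]_n) (p : R[i]) :
  ~ interior (numerical_range A : set R[i]^o) p ->
  exists2 mu : R[i], mu != 0 &
    forall z, numerical_range A z -> complex.Re (mu^* * (z - p)) <= 0.
Proof.
move=> np.
pose K (x y : R) := numerical_range A (p + Complex x y).
have cK : convex2 K.
  move=> x1 y1 x2 y2 l k1 k2 hl; have := numerical_range_convex _ _ _ _ k1 k2 hl.
  rewrite /K; congr numerical_range; case: p {np K k1 k2} => a b.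
  rewrite -(rmorph1 (real_complex R)) -rmorphB /=; simpc.
  by congr Complex; ring.
have [[[m1 m2] m0 Hm]|[e e0 He]] := convex2_support K cK.
  exists (Complex m1 m2).
    by apply: contra m0; rewrite eq_complex xpair_eqE.
  move=> z Wz; have := Hm (complex.Re (z - p)) (complex.Im (z - p)).
  rewrite /K /=.
  have -> : p + Complex (complex.Re (z - p)) (complex.Im (z - p)) = z.
    by case: (z) (p) => a b [c d] /=; simpc; congr Complex; ring.
  by move=> /(_ Wz); case: (z - p) => a b /=; rewrite mulNr opprK.
case: np; apply/interiorP_complex; exists e => // z pz.
have := He (complex.Re (z - p)) (complex.Im (z - p)); rewrite /K.
have -> : p + Complex (complex.Re (z - p)) (complex.Im (z - p)) = z.
  by case: (z) (p) => a b [c d] /=; simpc; congr Complex; ring.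
rewrite distrC in pz; apply; rewrite -ltcR; apply: le_lt_trans pz.
  exact: normc_ge_Re.
rewrite -[`|complex.Im _|]normrN -ReiNIm; apply: (le_trans (normc_ge_Re _)).
by rewrite complexiE normrM normCi mulr1.
Qed.

(** The coefficients [w] and [v] are independent, not conjugate, so that the vanishing of the
    determinant can be continued to complex parameters. *)
Definition pencil {C : numClosedFieldType} {n} (A : 'M[C]_n) (z w v : C) : 'M[C]_n :=
  z%:M - w *: A^t* - v *: A.

Lemma dotmx_adj {C : numClosedFieldType} {n} (B : 'M[C]_n) (x y : 'rV[C]_n) :
  dotmx (x *m B^t*) y = dotmx x (y *m B).
Proof. by rewrite !dotmxE trmx_mul map_mxM mulmxA. Qed.

(** [Re (mu^* p)] is the supremum of a Hermitian form over unit vectors, hence an eigenvalue. The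
    inequality is stated on the closure, where the other points of an arc in the boundary lie. *)
Lemma boundary_support {R : realType} {n} (A : 'M[R[i]]_n) (p : R[i]) :
  boundary (numerical_range A) p ->
  exists mu : R[i], [/\ mu != 0,
    forall z, closure (numerical_range A : set R[i]^o) z ->
      complex.Re (mu^* * (z - p)) <= 0 &
    \det (pencil A (real_complex R (complex.Re (mu^* * p))) (mu / 2) (mu^* / 2)) = 0].
Proof.
move=> [clp nip].
have [mu mu0 Hmu] := numerical_range_support _ _ nip.
have nmu0 : 0 < `|mu| by rewrite normr_gt0.
have approx (q : R[i]) (e : R) : closure (numerical_range A : set R[i]^o) q ->
    0 < e -> exists2 z, numerical_range A z &
      complex.Re (mu^* * q) - e < complex.Re (mu^* * z).
  move=> cq e0; pose r := complex.Re `|mu|.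
  have rE : real_complex R r = `|mu| by rewrite RRe_real // normr_real.
  have r0 : 0 < r by rewrite -ltcR rE.
  (* [Re (mu^* z)] is Lipschitz in [z] with constant [r = |mu|], whence the radius [e / r]. *)
  have /closureP_complex/(_ (e / r)) [|z Wz qz] := cq; first by rewrite divr_gt0.
  exists z => //; rewrite ltrBlDr -ltrBlDl -raddfB -mulrBr -ltcR.
  apply: (@le_lt_trans _ _ `|mu^* * (q - z)|).
    by apply: le_trans (normc_ge_Re _); rewrite lecR ler_norm.
  by rewrite normrM norm_conjC -ltr_pdivlMl // mulrC -rE -fmorphV -rmorphM.
exists mu; split=> //.
  move=> z cz; rewrite leNgt; apply/negP => h.
  have [y Wy] := approx z _ cz h.
  rewrite mulrBr raddfB opprB addrC subrK => hy.
  by have := Hmu y Wy; rewrite mulrBr raddfB subr_le0 leNgt hy.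
pose H := 2^-1 *: (mu^* *: A^T + mu *: A^T^t*).
have HE x : dotmx (x *m H) x =
    real_complex R (complex.Re (mu^* * dotmx (x *m A^T) x)).
  rewrite -scalemxAr dotmxZl mulmxDr -!scalemxAr dotmxDl !dotmxZl.
  rewrite dotmx_adj [dotmx x (_ *m _)]hermC expr0 mul1r ReJ_add mulrC.
  by congr (_ / _); rewrite -[X in X + _]mulr1; rewrite mulr1 rmorphM /= conjcK.
have HE' : pencil A (real_complex R (complex.Re (mu^* * p))) (mu / 2) (mu^* / 2)
    = ((real_complex R (complex.Re (mu^* * p)))%:M - H)^T.
  apply/matrixP => i j; rewrite !mxE eq_sym; ring.
rewrite HE' det_tr; apply: det_sub_sup_eq0.
- apply/is_hermitianmxP; rewrite expr0 scale1r; apply/matrixP => i j.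
  rewrite !mxE !rmorphM !rmorphD !rmorphM /= !conjCK fmorphV rmorph_nat.
  by rewrite [_ + mu * _]addrC.
- move=> x x1; rewrite HE lecR -subr_le0 -raddfB -mulrBr; apply: Hmu.
  by apply/numerical_rangeP; exists x.
- move=> e e0.
  have er : real_complex R (complex.Re e) = e.
    by rewrite RRe_real // ger0_real // ltW.
  have [|z /numerical_rangeP[x [x1 ->]] hz] := approx p (complex.Re e) clp.
    by rewrite -ltcR er.
  by exists x => //; rewrite HE -er -rmorphB ltcR.
Qed.

(** * Elliptic arcs *)

Lemma trig_max_critical {R : realType} (X Y s t t0 : R) :
  s < t0 < t ->
  (forall th, s <= th <= t ->
    X * cos th + Y * sin th <= X * cos t0 + Y * sin t0) ->
  X * sin t0 = Y * cos t0.
Proof.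
move=> /andP[st0 t0t] H.
pose f := X \*: (@cos R) + Y \*: (@sin R).
have df (x : R) : is_derive x 1 f (X *: - sin x + Y *: cos x).
  by rewrite /f; apply: is_deriveD.
have t0in : t0 \in `]s, t[ by rewrite in_itv /= st0.
have [_] : is_derive t0 1 f 0.
  apply: (derive1_at_max (a := s) (b := t)) => //.
  - exact: ltW (lt_trans st0 t0t).
  - by move=> th; rewrite in_itv /= => /andP[h1 h2]; apply: H; rewrite !ltW.
have [_ ->] := df t0.
rewrite /GRing.scale /= mulrN addrC => /eqP; rewrite subr_eq0 => /eqP -> //.
Qed.

Lemma pencilZ {C : numClosedFieldType} {n} (A : 'M[C]_n) (k z w v : C) :
  \det (pencil A (k * z) (k * w) (k * v)) = k ^+ n * \det (pencil A z w v).
Proof.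
by rewrite -detZ; congr (\det _); apply/matrixP => i j; rewrite !mxE; ring.
Qed.

Definition circle_point {R : realType} (t : R) : R[i] := Complex (cos t) (sin t).

Lemma circle_pointJ {R : realType} (t : R) :
  circle_point t * (circle_point t)^* = 1.
Proof.
rewrite /circle_point; simpc => /=.
by congr Complex; [rewrite -!expr2 cos2Dsin2|ring].
Qed.

Lemma circle_point_inj {R : realType} (s t : R) :
  `|s - t| < pi -> circle_point s = circle_point t -> s = t.
Proof.
wlog st : s t / t <= s => [hw|].
  have [/hw//|/ltW h] := leP t s.
  by rewrite distrC => h1 /esym h2; apply/esym/hw.
rewrite ger0_norm ?subr_ge0 // => lt [ec es].
have : cos (s - t) = cos 0.
  by rewrite cosB ec es -!expr2 cos2Dsin2 cos0.
move/cos_inj; rewrite !in_itv /= lexx subr_ge0 st (ltW lt) pi_ge0 => /(_ isT isT).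
by move/eqP; rewrite subr_eq0 => /eqP.
Qed.

Lemma poly_circle_arc_eq0 {R : realType} (s t : R) (P : {poly R[i]}) :
  s < t -> (forall th, s < th < t -> root P (circle_point th)) -> P = 0.
Proof.
move=> st H; apply/eqP/negPn/negP => P0.
(* [N] sample angles give [N] distinct roots, too many for a nonzero [P]; [h <= 1] keeps them less
   than [pi] apart, where [circle_point] is injective. *)
pose N := size P; pose h := Num.min (t - s) 1.
have h0 : 0 < h by rewrite lt_min subr_gt0 st ltr01.
pose pt (k : nat) := s + h * (k.+1%:R / N.+1%:R).
have N0 : 0 < N.+1%:R :> R by rewrite ltr0n.
have ptin k : (k < N)%N -> s < pt k < s + h.
  move=> kN; rewrite /pt ltrDl mulr_gt0 ?divr_gt0 ?ltr0n //=.
  by rewrite ltrD2l gtr_pMr // ltr_pdivrMr // mul1r ltr_nat ltnS.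
have := @max_poly_roots _ P [seq circle_point (pt k) | k <- iota 0 N] P0.
rewrite size_map size_iota ltnn => F; suff: false by []; apply: F.
  apply/allP => x /mapP[k kin ->]; move: kin; rewrite mem_iota /= add0n => kN.
  have /andP[h1 h2] := ptin k kN; apply: H; rewrite h1 (lt_le_trans h2) //.
  by rewrite addrC -lerBrDr ge_min lexx.
rewrite map_inj_in_uniq ?iota_uniq // => j k.
rewrite !mem_iota /= !add0n => /ptin/andP[j1 j2] /ptin/andP[k1 k2].
move/circle_point_inj => e; have {e} : pt j = pt k.
  apply: e; have h1 : h <= 1 by rewrite ge_min lexx orbT.
  have := pi_ge2 R; rewrite ltr_norml => pi2; apply/andP; split; lra.
move/addrI/(mulfI (lt0r_neq0 h0))/(mulIf _); rewrite invr_eq0 gt_eqF // => /(_ isT).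
by move/eqP; rewrite eqr_nat => /eqP [].
Qed.

Lemma conjC_RtoC {R : realType} (x : R) :
  (real_complex R x)^* = real_complex R x.
Proof. exact: conjc_real. Qed.

(** [nu] is normal to the ellipse at angle [th], where [Re (nu^* z)] equals [p q + Re (nu^* c)]. The
    normal given by [boundary_support] is a real multiple of [nu], and homogeneity of the pencil
    removes the factor. *)
Lemma arc_pencil_det {R : realType} {n} (A : 'M[R[i]]_n) (c u : R[i])
    (p q s t th : R) :
  `|u| = 1 -> 0 < p -> 0 < q -> s < th < t ->
  (forall a, s <= a <= t ->
     boundary (numerical_range A) (ellipse_point c u p q a)) ->
  let nu := u * Complex (q * cos th) (p * sin th) in
  \det (pencil A (real_complex R (p * q) + real_complex R (complex.Re (nu^* * c)))
                 (nu / 2) (nu^* / 2)) = 0.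
Proof.
move=> u1 p0 q0 thst H nu.
have /andP[/ltW th1 /ltW th2] := thst.
have uu : u * u^* = 1 by rewrite -normCK u1 expr1n.
have [mu [mu0 Hle Hdet]] := boundary_support _ _ (H th (introT andP (conj th1 th2))).
pose m := mu^* * u; pose X := complex.Re m * p; pose Y := - complex.Im m * q.
(* [X cos a + Y sin a] is the varying part of [Re (mu^* z)] along the arc, maximal at [th]; so
   [(X, Y)] is proportional to [(cos th, sin th)]. *)
have crit : X * sin th = Y * cos th.
  apply: (trig_max_critical _ _ s t) => // a hst.
  have [cla _] := H a hst.
  have := Hle _ cla; rewrite /ellipse_point opprD addrACA subrr add0r -mulrBr.
  rewrite mulrA -/m /X /Y; case: (m) => m1 m2; simpc => /=; lra.
pose k := X * cos th + Y * sin th.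
have cs : cos th ^+ 2 + sin th ^+ 2 = 1 by exact: cos2Dsin2.
have kX : X = k * cos th.
  rewrite -[LHS]mulr1 -cs /k mulrDr !expr2 (mulrA X (sin th)) crit; ring.
have kY : Y = k * sin th.
  rewrite -[LHS]mulr1 -cs /k mulrDr !expr2 (mulrA Y (cos th)) -crit; ring.
pose kap := k / (p * q).
have [p0' q0'] : p != 0 /\ q != 0 by rewrite !gt_eqF.
pose d : R[i] := Complex (q * cos th) (p * sin th).
have dJ : d^* = Complex (q * cos th) (- (p * sin th)) by [].
have mE : m = real_complex R kap * d^*.
  have mre : complex.Re m = kap * (q * cos th).
    by apply: (mulIf p0'); rewrite -/X kX /kap; field; rewrite p0' q0'.
  have mim : complex.Im m = - (kap * (p * sin th)).
    apply: (mulIf q0'); apply: oppr_inj; rewrite -mulNr -/Y kY /kap; field.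
    by rewrite p0' q0'.
  rewrite dJ; case: (m) mre mim => m1 m2 /= -> ->; simpc.
  by congr Complex; rewrite mulrN.
have muE : mu = real_complex R kap * nu.
  have -> : mu = u * m^* by rewrite /m rmorphM /= conjCK mulrCA uu mulr1.
  by rewrite mE rmorphM /= conjCK conjC_RtoC mulrCA.
have kap0 : real_complex R kap != 0.
  by apply: contra mu0 => /eqP k0; rewrite muE k0 mul0r.
move: Hdet.
have -> : real_complex R (complex.Re (mu^* * ellipse_point c u p q th)) = real_complex R kap *
  (real_complex R (p * q) + real_complex R (complex.Re (nu^* * c))).
  rewrite muE rmorphM /= conjC_RtoC -rmorphD /= -rmorphM /=; congr (real_complex R _).
  rewrite -mulrA.
  have -> : nu^* * ellipse_point c u p q th
      = nu^* * c + d^* * Complex (p * cos th) (q * sin th).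
    rewrite mulrDr /nu -/d rmorphM /= mulrA; congr (_ + _ * _).
    by rewrite mulrAC [u^* * u]mulrC uu mul1r.
  rewrite dJ; case: (nu^* * c) => x y; simpc => /=.
  rewrite -[X in kap * (X + x)]mulr1 -cs; ring.
have -> : mu / 2 = real_complex R kap * (nu / 2) by rewrite muE mulrA.
have -> : mu^* / 2 = real_complex R kap * (nu^* / 2).
  by rewrite muE rmorphM /= conjC_RtoC mulrA.
by move/eqP; rewrite pencilZ mulf_eq0 expf_eq0 (negbTE kap0) andbF => /eqP.
Qed.

Lemma horner_det_pencil {C : numClosedFieldType} {n} (A : 'M[C]_n)
    (zP wP vP : {poly C}) (x : C) :
  (\det (zP%:M - wP *: map_mx polyC (A^t*) - vP *: map_mx polyC A)).[x] =
  \det (pencil A zP.[x] wP.[x] vP.[x]).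
Proof.
rewrite -[LHS]/(horner_eval x _) -det_map_mx; congr (\det _).
apply/matrixP => i j; rewrite !mxE /= /horner_eval.
by rewrite !(hornerD, hornerN, hornerM, hornerC, hornerMn).
Qed.

(** For [x = e^(i th)] one has [x^* = 1 / x], so scaling the triple of [arc_pencil_det] by [x] turns
    [nu / 2] and [nu^* / 2] into the polynomials [w] and [v]. The determinant is then a polynomial
    in [x] that vanishes on an arc. *)
Lemma arc_pencil_identity {R : realType} {n} (A : 'M[R[i]]_n) (c u : R[i])
    (p q s t : R) :
  `|u| = 1 -> 0 < p -> 0 < q -> s < t ->
  (forall a, s <= a <= t ->
     boundary (numerical_range A) (ellipse_point c u p q a)) ->
  forall x : R[i],
  let P := real_complex R p in let Q := real_complex R q in
  let w := u / 4 * ((P + Q) * x ^+ 2 + (Q - P)) in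
  let v := u^* / 4 * ((P + Q) + (Q - P) * x ^+ 2) in
  \det (pencil A (P * Q * x + c^* * w + c * v) w v) = 0.
Proof.
move=> u1 p0 q0 st H x P Q w v.
pose wP : {poly R[i]} := (u / 4) *: ((P + Q) *: 'X ^+ 2 + (Q - P)%:P).
pose vP : {poly R[i]} := (u^* / 4) *: ((P + Q)%:P + (Q - P) *: 'X ^+ 2).
pose zP : {poly R[i]} := (P * Q) *: 'X + c^* *: wP + c *: vP.
have wE y : wP.[y] = u / 4 * ((P + Q) * y ^+ 2 + (Q - P)).
  by rewrite /wP !hornerE.
have vE y : vP.[y] = u^* / 4 * ((P + Q) + (Q - P) * y ^+ 2).
  by rewrite /vP !hornerE.
have zE y : zP.[y] = P * Q * y + c^* * wP.[y] + c * vP.[y].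
  by rewrite /zP !hornerE.
pose F := \det (zP%:M - wP *: map_mx polyC (A^t*) - vP *: map_mx polyC A).
suff F0 : F = 0.
  by have := horner_det_pencil A zP wP vP x; rewrite -/F F0 horner0 zE wE vE.
apply: (poly_circle_arc_eq0 s t) => // th hth.
rewrite /root horner_det_pencil zE.
have := arc_pencil_det A c u p q s t th u1 p0 q0 hth H.
set nu := u * _; set y := circle_point th => /= Hdet.
have yJ : y * y^* = 1 by exact: circle_pointJ.
have nuE : nu = u * ((P + Q) / 2 * y + (Q - P) / 2 * y^*).
  rewrite /nu; congr (_ * _).
  have yE : y = real_complex R (cos th) + 'i%C * real_complex R (sin th).
    by rewrite [y]complexE.
  have yJE : y^* = real_complex R (cos th) - 'i%C * real_complex R (sin th).
    by rewrite [LHS]complexE /=; simpc.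
  by rewrite yJE yE [LHS]complexE /= !rmorphM /= -/P -/Q; field.
have wy : wP.[y] = y * (nu / 2).
  have -> : y * (nu / 2) = u / 4 * ((P + Q) * y ^+ 2 + (Q - P) * (y * y^*)).
    by rewrite nuE; field.
  by rewrite wE yJ mulr1.
have nuJ : nu^* = u^* * ((P + Q) / 2 * y^* + (Q - P) / 2 * y).
  rewrite nuE !(rmorphM, rmorphD) /= conjCK fmorphV rmorph_nat.
  by rewrite /P /Q rmorphN /= !conjC_RtoC.
have vy : vP.[y] = y * (nu^* / 2).
  have -> : y * (nu^* / 2) =
      u^* / 4 * ((P + Q) * (y * y^*) + (Q - P) * y ^+ 2).
    by rewrite nuJ; field.
  by rewrite vE yJ mulr1.
have -> : P * Q * y + c^* * wP.[y] + c * vP.[y] =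
    y * (real_complex R (p * q) + real_complex R (complex.Re (nu^* * c))).
  have -> : real_complex R (complex.Re (nu^* * c)) = (nu^* * c + nu * c^*) / 2.
    have e : (nu^* * c)^* = nu * c^* by rewrite rmorphM /= conjCK.
    by rewrite ReJ_add -e.
  by rewrite wy vy rmorphM /= -/P -/Q; field.
by rewrite wy vy pencilZ Hdet mulr0.
Qed.

Lemma det_pencil_v0 {C : numClosedFieldType} {n} (A : 'M[C]_n) (z w : C) :
  (forall i j : 'I_n, (j <= i)%N -> A i j = 0) ->
  \det (pencil A z w 0) = z ^+ n.
Proof.
move=> hA; rewrite det_trig.
  under eq_bigr => i _ do
    rewrite !mxE eqxx mulr1n hA // conjC0 mulr0 mul0r !subr0.
  by rewrite prodr_const card_ord.
apply/is_trig_mxP => i j ij; rewrite !mxE hA ?(ltnW ij) //.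
by rewrite -val_eqE ltn_eqF // conjC0 mulr0 mul0r !subr0.
Qed.

Lemma det_pencil_w0 {C : numClosedFieldType} {n} (A : 'M[C]_n) (z v : C) :
  (forall i j : 'I_n, (j <= i)%N -> A i j = 0) ->
  \det (pencil A z 0 v) = z ^+ n.
Proof.
move=> hA; rewrite -det_tr det_trig.
  under eq_bigr => i _ do
    rewrite !mxE eqxx mulr1n hA // mulr0 mul0r !subr0.
  by rewrite prodr_const card_ord.
apply/is_trig_mxP => i j ij; rewrite !mxE [A j i]hA ?(ltnW ij) //.
by rewrite -val_eqE gtn_eqF // mulr0 mul0r !subr0.
Qed.

(* For a nilpotent triangular matrix the determinant of the pencil is a power of
   [z] on the lines [v = 0] and [w = 0]; this forces the foci of the ellipse to
   be 0. *)
Lemma nilpotent_arc_circle {R : realType} {n} (A : 'M[R[i]]_n) :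
  (forall i j : 'I_n, (j <= i)%N -> A i j = 0) ->
  contains_elliptic_arc (boundary (numerical_range A)) ->
  exists2 r : R, 0 < r &
    forall w v, w * v = 4^-1 -> \det (pencil A (real_complex R r) w v) = 0.
Proof.
move=> hA [_ [[c [u [p [q [s [t [u1 p0 q0 st ->]]]]]]] HE]].
have H a : s <= a <= t ->
    boundary (numerical_range A) (ellipse_point c u p q a).
  by move=> ast; apply: HE; exists a => //=; rewrite in_itv.
have := arc_pencil_identity A c u p q s t u1 p0 q0 st H => /=.
set P := real_complex R p; set Q := real_complex R q => id0.
have P0 : 0 < P by rewrite ltcR.
have Q0 : 0 < Q by rewrite ltcR.
have nP : P != 0 by rewrite gt_eqF.
have nQ : Q != 0 by rewrite gt_eqF.
have uu : u * u^* = 1 by rewrite -normCK u1 expr1n.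
have nu : u != 0 by rewrite -normr_eq0 u1 oner_eq0.
have root0 (z : R[i]) : z ^+ n = 0 -> z = 0.
  by move/eqP; rewrite expf_eq0 => /andP[_ /eqP].
(* Otherwise [v] vanishes at two points [x0] and [- x0], where [w] takes the same value. The
   [z]-coordinate must vanish at both, so the difference [2 P Q x0] is zero, against [P + Q > 0]. *)
have PQ : P = Q.
  apply/eqP/negPn/negP => neq.
  have dPQ : P - Q != 0 by rewrite subr_eq0.
  pose x0 := sqrtC ((P + Q) / (P - Q)).
  have x02 : x0 ^+ 2 = (P + Q) / (P - Q) by rewrite sqrtCK.
  have v0 : u^* / 4 * (P + Q + (Q - P) * x0 ^+ 2) = 0.
    by rewrite x02; field.
  have := id0 x0; have := id0 (- x0).
  rewrite sqrrN v0 !mulr0 !addr0 !det_pencil_v0 // => /root0 e1 /root0 e2.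
  have /eqP : 2 * (P * Q) * x0 = 0.
    by rewrite -[RHS]subr0 -[X in _ = X - _]e2 -[X in _ = _ - X]e1; ring.
  rewrite !mulf_eq0 pnatr_eq0 (negbTE nP) (negbTE nQ) /= => /eqP xx.
  move: x02; rewrite xx expr0n /= => /esym/eqP.
  by rewrite mulf_eq0 invr_eq0 (negbTE dPQ) orbF gt_eqF // addr_gt0.
(* At [x = 0] the curve has [w = 0] and [z = c * v] with [v] nonzero. *)
have c0 : c = 0.
  have := id0 0; rewrite -PQ subrr expr0n /= !(mulr0, mul0r, addr0, add0r).
  rewrite det_pencil_w0 // => /root0/eqP.
  rewrite !mulf_eq0 conjC_eq0 (negbTE nu) invr_eq0 pnatr_eq0 /= -mulr2n.
  by rewrite mulrn_eq0 (negbTE nP) !orbF => /eqP.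
exists p => // w v wv; rewrite -/P.
have nw : w != 0.
  apply: contra_eq_neq wv => ->; rewrite mul0r eq_sym.
  by rewrite invr_eq0 pnatr_eq0.
pose k := 2 * P * w * u^*.
have k0 : k != 0.
  by rewrite !mulf_eq0 conjC_eq0 pnatr_eq0 (negbTE nP) (negbTE nw) (negbTE nu).
(* At this [x] the point of the curve is [k] times [(P, w, v)]. *)
have := id0 (2 * w * u^*); rewrite c0 -PQ subrr conjC0 !mul0r !addr0.
have -> : P * P * (2 * w * u^*) = k * P by rewrite /k; ring.
have -> : u / 4 * ((P + P) * (2 * w * u^*) ^+ 2) = k * w.
  have -> : u / 4 * ((P + P) * (2 * w * u^*) ^+ 2) =
    2 * P * w * (u * u^*) * u^* * w by field.
  by rewrite uu mulr1.
have -> : u^* / 4 * (P + P) = k * v.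
  have -> : k * v = 2 * P * (w * v) * u^* by rewrite /k; ring.
  by rewrite wv; field.
rewrite pencilZ => /eqP; rewrite mulf_eq0 expf_eq0 (negbTE k0) andbF /=.
by move=> /eqP.
Qed.

(** * The KMS pencil *)

Definition shift {C : pzRingType} n : 'M[C]_n := \matrix_(i, j) (i.+1 == j)%:R.

(** [F] extends a row of [A] to all natural indices, so that the neighbouring column can be named
    without a bound proof. *)
Lemma mulmx_shift {C : pzRingType} {m n} (A : 'M[C]_(m, n)) (F : 'I_m -> nat -> C) i j :
  (forall k : 'I_n, A i k = F i k) ->
  (A *m shift n) i j = if (0 < j)%N then F i j.-1 else 0.
Proof.
move=> hF; rewrite !mxE; case: j => [[|j] jn] /=.
  by rewrite big1 // => k _; rewrite mxE mulr0.
rewrite (bigD1 (Ordinal (ltnW jn))) //= big1 ?addr0 => [|k kj].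
  by rewrite mxE eqxx mulr1 hF.
by rewrite mxE eqSS; move: kj; rewrite -val_eqE /= => /negbTE ->; rewrite mulr0.
Qed.

Lemma mulmx_shiftT {C : pzRingType} {m n} (A : 'M[C]_(m, n)) (F : 'I_m -> nat -> C) i j :
  (forall k : 'I_n, A i k = F i k) ->
  (A *m (shift n)^T) i j = if (j.+1 < n)%N then F i j.+1 else 0.
Proof.
move=> hF; rewrite !mxE; case: ifP => [jn|jn].
  rewrite (bigD1 (Ordinal jn)) //= big1 ?addr0 => [|k kj].
    by rewrite !mxE eqxx mulr1 hF.
  rewrite !mxE [_ == _ :> nat]eq_sym; move: kj; rewrite -val_eqE /= => /negbTE ->.
  by rewrite mulr0.
rewrite big1 // => k _; rewrite !mxE; case: eqP => [e|]; last by rewrite mulr0.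
by have := ltn_ord k; rewrite -e jn.
Qed.

(** The KMS matrix is the geometric series of the powers [(a N)^k], [k >= 1]; its first term is
    split off. *)
Lemma KMS_shift {R : realType} n (a : R[i]) :
  KMS_matrix n a = a *: shift n + a *: (KMS_matrix n a *m shift n).
Proof.
apply/matrixP => i j; rewrite 2![in RHS]mxE [in X in _ = _ + X]mxE.
rewrite (mulmx_shift _ (fun i k => if (i < k)%N then a ^+ (k - i) else 0)); last first.
  by move=> k; rewrite mxE.
rewrite !mxE; case: (j : nat) => [|k] /=; first by rewrite !mulr0 addr0.
rewrite ltnS leq_eqVlt eqSS; case: eqP => [->|_] /=.
  by rewrite ltnn mulr0 addr0 subSnn expr1 mulr1.
case: ltnP => [ik|_]; last by rewrite !mulr0 addr0.
by rewrite mulr0 add0r subSn ?(ltnW ik) // exprS.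
Qed.

Lemma mulmx_congr_pencil {C : comPzRingType} {n} (L U A B : 'M[C]_n) (z w v : C) :
  L *m (z%:M - w *: B - v *: A) *m U =
  z *: (L *m U) - w *: (L *m B *m U) - v *: (L *m (A *m U)).
Proof.
rewrite !mulmxBr mul_mx_scalar -!scalemxAr !mulmxBl -!scalemxAl.
by rewrite -[L *m A *m U]mulmxA.
Qed.

Lemma det_unimodular_congr {C : comPzRingType} {n} (L M U T : 'M[C]_n) :
  \det L = 1 -> \det U = 1 -> L *m M *m U = T -> \det M = \det T.
Proof. by move=> dL dU <-; rewrite !det_mulmx dL dU mul1r mulr1. Qed.

Lemma tridiag_pencilE {C : comPzRingType} {n} (N NT NN : 'M[C]_n)
    (a b z w v : C) :
  z *: (1%:M - a *: N - (b *: NT - b *: (a *: NN)))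
    - w *: (b *: NT - b *: (a *: NN)) - v *: (a *: (N - b *: NN)) =
  z%:M + (a * b * (z + w + v)) *: NN - (a * (z + v)) *: N - (b * (z + w)) *: NT.
Proof. by apply/matrixP => i j; rewrite !mxE -mulr_natr; ring. Qed.

(** The right factor turns [A] into [a N] and the left one turns [A^t*] into [a^* N^T], leaving only
    products of at most one [N^T] and one [N]. *)
Lemma KMS_pencil_tridiag {R : realType} n (a z w v : R[i]) :
  (1%:M - a^* *: (shift n)^T) *m pencil (KMS_matrix n a) z w v
    *m (1%:M - a *: shift n) =
  z%:M + (a * a^* * (z + w + v)) *: ((shift n)^T *m shift n)
  - (a * (z + v)) *: shift n - (a^* * (z + w)) *: (shift n)^T.
Proof.
set N := shift n; set A := KMS_matrix n a.
have AU : A *m (1%:M - a *: N) = a *: N.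
  by rewrite mulmxBr mulmx1 -scalemxAr {1}/A KMS_shift addrK.
have NJ : N^t* = N^T.
  by apply/matrixP => i j; rewrite !mxE rmorph_nat.
have LA : (1%:M - a^* *: N^T) *m A^t* = a^* *: N^T.
  have := congr1 (fun M : 'M[R[i]]_n => M^t*) AU => /=.
  rewrite trmx_mul map_mxM !raddfB /= !linearZ /= !map_mxZ trmx1 map_mx1 NJ.
  by rewrite scalerN.
rewrite /pencil mulmx_congr_pencil LA AU mulmxBl !mulmxBr !mulmx1 !mul1mx.
rewrite -!scalemxAl -!scalemxAr [(_ - _) *m N]mulmxBl mul1mx.
rewrite -scalemxAl; exact: tridiag_pencilE.
Qed.

Lemma det_KMS_pencil {R : realType} n (a z w v : R[i]) :
  \det (pencil (KMS_matrix n a) z w v) =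
  \det (z%:M + (a * a^* * (z + w + v)) *: ((shift n)^T *m shift n)
  - (a * (z + v)) *: shift n - (a^* * (z + w)) *: (shift n)^T).
Proof.
have dL : \det (1%:M - a^* *: (shift n)^T) = 1.
  rewrite det_trig.
    by rewrite big1 // => i _; rewrite !mxE eqxx gtn_eqF // mulr0 subr0.
  apply/is_trig_mxP => i j ij; rewrite !mxE -val_eqE ltn_eqF // gtn_eqF ?mulr0 ?subr0 //.
  exact: ltnW.
have dU : \det (1%:M - a *: shift n) = 1.
  rewrite -det_tr det_trig.
    by rewrite big1 // => i _; rewrite !mxE eqxx gtn_eqF // mulr0 subr0.
  apply/is_trig_mxP => i j ij; rewrite !mxE -val_eqE gtn_eqF // gtn_eqF ?mulr0 ?subr0 //.
  exact: ltnW.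
exact: det_unimodular_congr dL dU (KMS_pencil_tridiag n a z w v).
Qed.

(** The missing first diagonal entry is the corner by which the tridiagonal matrix fails to be
    Toeplitz. *)
Lemma shiftT_mul_shift {C : pzRingType} n (i j : 'I_n) :
  ((shift n)^T *m shift n) i j = ((0 < j)%N && (i == j))%:R :> C.
Proof.
rewrite (mulmx_shift _ (fun i k => (k.+1 == i)%:R)); last by move=> k; rewrite !mxE.
by case: ifP => //= j0; rewrite prednK // eq_sym.
Qed.

(* On the line [w = - r] the tridiagonal matrix is triangular. *)
Lemma KMS_circle_radius {R : realType} n (a r : R[i]) : r != 0 ->
  \det (pencil (KMS_matrix n a) r (- r) (- (4 * r)^-1)) = 0 ->
  (1 < n)%N /\ a * a^* = 4 * r ^+ 2.
Proof.
move=> r0; rewrite det_KMS_pencil subrr mulr0 scale0r subr0 add0r.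
set v := - (4 * r)^-1; set T := _ - _ => detT.
have TE i j : T i j = r *+ (i == j) +
    a * a^* * v * ((0 < j)%N && (i == j))%:R - a * (r + v) * (i.+1 == j)%:R.
  rewrite -shiftT_mul_shift /T; move: ((shift n)^T *m _) => NN.
  by rewrite !mxE.
have : \det T^T = 0 by rewrite det_tr.
rewrite det_trig; last first.
  apply/is_trig_mxP => i j ij; rewrite mxE TE -val_eqE gtn_eqF // andbF.
  by rewrite gtn_eqF ?ltnS ?(ltnW ij) //= mulr0n !mulr0 addr0 subr0.
(* The corner entry is [r], nonzero, so the vanishing diagonal entry [r + a a^* v] sits at some
   [i > 0]. *)
move/eqP/prodf_eq0 => [i _]; rewrite mxE TE eqxx andbT gtn_eqF // mulr0 subr0.
case: (posnP i) => [_|i0]; first by rewrite mulr0 addr0 (negbTE r0).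
rewrite mulr1 mulr1n /v => /eqP e; split.
  exact: leq_ltn_trans i0 (ltn_ord i).
apply/eqP; rewrite -subr_eq0; apply/eqP.
have -> : a * a^* - 4 * r ^+ 2 = - (4 * r) * (r + a * a^* * - (4 * r)^-1).
  by field.
by rewrite e mulr0.
Qed.

(** The rows are abstract so that [mxE] does not open the matrix products substituted for them. *)
Lemma lincomb_entry {C : pzRingType} {n} (x M1 M2 M3 : 'rV[C]_n) (r d b m : C) j :
  r *: x + d *: M3 - b *: M1 - m *: M2 = 0 ->
  r * x 0 j + d * M3 0 j - b * M1 0 j - m * M2 0 j = 0.
Proof. by move/rowP/(_ j); rewrite !mxE. Qed.

(* When [(r + w) * (r + v) = 1] the recurrence satisfied by a kernel vector has
   characteristic polynomial [(x - kap)^2], hence the explicit solution; the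
   last equation reads [n = 2]. *)
Lemma KMS_kernel_order2 {R : realType} n (a r w v : R[i]) : r != 0 ->
  a * a^* = 4 * r ^+ 2 -> w * v = 4^-1 -> (r + w) * (r + v) = 1 ->
  (1 < n)%N -> \det (pencil (KMS_matrix n a) r w v) = 0 -> n = 2%N.
Proof.
move=> r0 rho wv rwv; case: n => // n n0.
rewrite det_KMS_pencil => /eqP/det0P[x x0].
have a0 : a != 0.
  apply: contra_eq_neq rho => ->; rewrite mul0r eq_sym mulf_eq0 pnatr_eq0 /=.
  by rewrite expf_eq0.
have rw0 : r + w != 0.
  by apply: contra_eq_neq rwv => ->; rewrite mul0r eq_sym oner_eq0.
pose m := a^* * (r + w); have m0 : m != 0 by rewrite mulf_neq0 ?conjC_eq0.
(* Divided by [m], the interior equations become [X (j + 1) = 2 kap X j - kap^2 X (j - 1)]. *)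
pose kap := 2 * r / m.
have kap0 : kap != 0 by rewrite !mulf_neq0 ?pnatr_eq0 ?invr_eq0.
have mE : m = 2 * r / kap by rewrite /kap; field; rewrite m0 r0.
have aE : a * (r + v) = 2 * r * kap.
  apply: (mulIf m0); rewrite /kap mulrA divfK //.
  have -> : a * (r + v) * m = a * a^* * ((r + w) * (r + v)) by rewrite /m; ring.
  by rewrite rho rwv; ring.
have dE : a * a^* * (r + w + v) = 3 * r.
  have : r * (r + w + v) = 3 / 4.
    have -> : r * (r + w + v) = (r + w) * (r + v) - w * v by ring.
    by rewrite rwv wv; field.
  move=> e; rewrite rho.
  have -> : 4 * r ^+ 2 * (r + w + v) = 4 * r * (r * (r + w + v)) by ring.
  by rewrite e; field.
rewrite -/m aE dE mulmxBr mulmxBr mulmxDr mul_mx_scalar -!scalemxAr => xT.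
pose X (k : nat) := x 0 (inord k).
have hX (k : 'I_n.+1) : x 0 k = X k by rewrite /X inord_val.
have rec (j : nat) : (j < n.+1)%N ->
    r * X j + 3 * r * (if (0 < j)%N then X j else 0)
    - 2 * r * kap * (if (0 < j)%N then X j.-1 else 0)
    - m * (if (j.+1 < n.+1)%N then X j.+1 else 0) = 0.
  move=> jn; pose j' := Ordinal jn.
  have e1 : (x *m shift n.+1) 0 j' = if (0 < j)%N then X j.-1 else 0.
    by rewrite (mulmx_shift _ (fun=> X)).
  have hT (k : 'I_n.+1) : (x *m (shift n.+1)^T) 0 k =
      if (k.+1 < n.+1)%N then X k.+1 else 0.
    by rewrite (mulmx_shiftT _ (fun=> X)).
  have e3 : (x *m ((shift n.+1)^T *m shift n.+1)) 0 j' =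
      if (0 < j)%N then X j else 0.
    rewrite mulmxA (mulmx_shift _ (fun _ k =>
      if (k.+1 < n.+1)%N then X k.+1 else 0)) //=.
    by case: posnP => // j0; rewrite prednK // jn.
  by have := lincomb_entry _ _ _ _ _ _ _ _ j' xT; rewrite e1 hT e3 hX.
have kapr : - (2 * r / kap) != 0 by rewrite oppr_eq0 -mE.
(* The corner equation [r X 0 = m X 1] gives [X 1 = kap X 0 / 2], whence the factor [1 - k / 2]. Two
   consecutive values are carried through the induction. *)
have sol (k : nat) : (k.+1 < n.+1)%N ->
    X k = X 0 * (1 - k%:R / 2) * kap ^+ k /\
    X k.+1 = X 0 * (1 - k.+1%:R / 2) * kap ^+ k.+1.
  elim: k => [|k IH] kn.
    have := rec 0%N isT; rewrite kn /= !mulr0 addr0 subr0 mE => e.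
    split; first by rewrite mul0r subr0 expr0 !mulr1.
    apply: (mulfI kapr); apply/eqP; rewrite -subr_eq0 -[X in _ == X]e.
    by apply/eqP; field.
  have [e1 e2] := IH (ltnW kn); split => //.
  have := rec k.+1 (ltnW kn); rewrite kn /= e1 e2 mE => e.
  apply: (mulfI kapr); apply/eqP; rewrite -subr_eq0 -[X in _ == X]e.
  rewrite -(addn2 k) -(addn1 k) !natrD !exprD; apply/eqP; field.
  by rewrite kap0.
(* The order is now [n.+2]. The last equation, which has no following term, leaves the factor
   [n]. *)
case: n n0 x x0 xT X hX rec sol => // n _ x x0 xT X hX rec sol.
have [e1 e2] := sol n (ltnSn _).
have := rec n.+1 (ltnSn _).
rewrite ltnn mulr0 subr0 /= e1 e2 => e.
have : X 0 * kap ^+ n.+1 * r * n%:R = 0.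
  by apply: oppr_inj; rewrite oppr0 -[RHS]e -(addn1 n) natrD exprD; field.
move/eqP; rewrite !mulf_eq0 expf_eq0 (negbTE kap0) (negbTE r0) !orbF pnatr_eq0.
move=> /orP[/eqP X0|/eqP -> //]; case/eqP: x0; apply/rowP => k.
rewrite mxE hX; case: k => [[|k] kn] //=.
by have [_ ->] := sol k kn; rewrite X0 !mul0r.
Qed.

(** * The equivalence *)

Lemma KMS_arc_order2 {R : realType} n (a : R[i]) :
  contains_elliptic_arc (boundary (numerical_range (KMS_matrix n a))) ->
  n = 2%N /\ a != 0.
Proof.
move=> /nilpotent_arc_circle[i j ji|r0 r0_gt0 H]; first by rewrite mxE ltnNge ji.
set r := real_complex R r0 in H.
have r_neq0 : r != 0 by rewrite gt_eqF // ltcR.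
have [|n1 rho] := KMS_circle_radius n a r r_neq0.
  by apply: H; field.
(* [w] and [v] are the roots of [T^2 - s T + 1 / 4], with [s] chosen so that
   [r^2 + r s + 1 / 4 = 1]. *)
pose s := (3 / 4 - r ^+ 2) / r; pose e := sqrtC (s ^+ 2 - 1).
have e2 : e ^+ 2 = s ^+ 2 - 1 by rewrite sqrtCK.
pose w := (s + e) / 2; pose v := (s - e) / 2.
have wv : w * v = 4^-1.
  have -> : w * v = (s ^+ 2 - e ^+ 2) / 4 by rewrite /w /v; field.
  by rewrite e2; field.
have rwv : (r + w) * (r + v) = 1.
  have -> : (r + w) * (r + v) = r ^+ 2 + r * s + w * v by rewrite /w /v; field.
  by rewrite wv /s; field.
split; first exact: KMS_kernel_order2 r_neq0 rho wv rwv n1 (H _ _ wv).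
apply: contra_eq_neq rho => ->.
by rewrite mul0r eq_sym mulf_neq0 ?pnatr_eq0 // expf_neq0.
Qed.

Lemma disc_boundary_arc {R : realType} (W : set R[i]) :
  is_circular_disc W -> contains_elliptic_arc (boundary W).
Proof.
move=> [c [r [r0 ->]]].
exists [set ellipse_point c 1 r r th | th in `[0, 1]]%classic; split.
  by exists c, 1, r, r, 0, 1; split => //; rewrite ?normr1.
move=> _ [th _ <-].
have ptE (k : R) :
    `|ellipse_point c 1 k k th - c| = real_complex R `|k|.
  rewrite normc_def /ellipse_point mul1r [c + _]addrC addrK /= !exprMn -mulrDr.
  by rewrite cos2Dsin2 mulr1 sqrtr_sqr.
split.
  by apply: subset_closure => /=; rewrite ptE lecR gtr0_norm.
move=> /interiorP_complex[e e0 H].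
have e20 : 0 < e / 2 by rewrite divr_gt0.
have re0 : 0 < r + e / 2 by rewrite addr_gt0.
(* Moving out by [e / 2] along the same ray stays in the ball but leaves the disc. *)
have := H (ellipse_point c 1 (r + e / 2) (r + e / 2) th) => /=.
rewrite ptE lecR (gtr0_norm re0) => F.
have : r + e / 2 <= r.
  apply: F.
  have -> : ellipse_point c 1 r r th - ellipse_point c 1 (r + e / 2) (r + e / 2) th
     = ellipse_point c 1 (- (e / 2)) (- (e / 2)) th - c.
    rewrite /ellipse_point !mul1r; case: c {ptE H} => x y; simpc => /=.
    by congr Complex; ring.
  by rewrite ptE ltcR normrN gtr0_norm //; lra.
by lra.
Qed.

(** The form is [a * x1 * x0^*], and [|x0| |x1|] is at most [1 / 2] on unit vectors; the radius is
    [|a| / 2]. *)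
Lemma KMS2_disc {R : realType} (a : R[i]) : a != 0 ->
  is_circular_disc (numerical_range (KMS_matrix 2 a)).
Proof.
move=> a0; pose r := complex.Re `|a| / 2.
have rE : real_complex R r = `|a| / 2.
  rewrite -[RHS](congr1 (fun y => y / 2) (RRe_real (normr_real a))).
  by rewrite [LHS]rmorphM fmorphV rmorph_nat.
have r0 : 0 < r by rewrite -ltcR rE divr_gt0 ?normr_gt0.
exists 0, r; split => //.
have sum2 (F : 'I_2 -> R[i]) : \sum_i F i = F 0 + F 1.
  by rewrite !big_ord_recl big_ord0 addr0; congr (_ + F _); apply/val_inj.
have qE (x : 'rV[R[i]]_2) :
    dotmx (x *m (KMS_matrix 2 a)^T) x = a * x 0 1 * (x 0 0)^*.
  rewrite dotmxE mxE sum2 ![(x *m _) _ _]mxE !sum2 !mxE /= subn0 expr1; ring.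
have nE (x : 'rV[R[i]]_2) : dotmx x x = `|x 0 0| ^+ 2 + `|x 0 1| ^+ 2.
  by rewrite dotmxE mxE sum2 !mxE !normCK.
apply/seteqP; split => z /=; rewrite subr0 rE.
  move=> /numerical_rangeP[x [x1 ->]]; move: x1; rewrite nE qE -mulrA normrM.
  rewrite ler_pM2l ?normr_gt0 // normrM norm_conjC => x1.
  rewrite -[_^-1]mul1r ler_pdivlMr // -subr_ge0 -[X in X - _]x1.
  have -> : `|x 0 0| ^+ 2 + `|x 0 1| ^+ 2 - `|x 0 1| * `|x 0 0| * 2 =
    (`|x 0 0| - `|x 0 1|) ^+ 2 by ring.
  by rewrite real_exprn_even_ge0 // rpredB ?normr_real.
move=> hz; apply/numerical_rangeP; pose y := z / a.
have hy : `|y| <= 2^-1.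
  by rewrite /y normrM normfV ler_pdivrMr ?normr_gt0 // mulrC.
(* The vector sought is [(s, y / s)] with [s > 0]; unit norm makes [s ^+ 2] a root of
   [T^2 - T + |y|^2], whose discriminant is [e ^+ 2]. *)
pose e := sqrtC (1 - 4 * `|y| ^+ 2).
have e0 : 0 <= e.
  rewrite sqrtC_ge0 subr_ge0.
  have e41 : 1 = 4 * 2^-1 ^+ 2 :> R[i] by field.
  rewrite [X in _ <= X]e41.
  by rewrite ler_pM2l // lerXn2r ?nnegrE // invr_ge0.
have e2 : e ^+ 2 = 1 - 4 * `|y| ^+ 2 by rewrite sqrtCK.
clearbody e.
have e1 : 0 < 1 + e by rewrite ltr_pwDl.
pose s := sqrtC ((1 + e) / 2).
have s0 : 0 < s by rewrite sqrtC_gt0 divr_gt0.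
have s2 : s ^+ 2 = (1 + e) / 2 by rewrite sqrtCK.
clearbody s.
pose x : 'rV[R[i]]_2 := \row_(i < 2) (if i == 0 then s else y / s).
have x0E : x 0 0 = s by rewrite mxE.
have x1E : x 0 1 = y / s by rewrite mxE.
exists x; rewrite qE nE x0E x1E normrM normfV (gtr0_norm s0) exprMn exprVn s2.
split.
  have -> : `|y| ^+ 2 = (1 - e ^+ 2) / 4 by rewrite e2; field.
  by field; rewrite gt_eqF.
rewrite conj_Creal ?gtr0_real // -mulrA divfK ?gt_eqF // /y mulrC divfK //.
Qed.

Theorem theorem2p3 (R : realType) (n : nat) (a : R[i]) (hn : (1 <= n)%N) :
  (is_circular_disc (numerical_range (KMS_matrix n a)) <->
   contains_elliptic_arc (boundary (numerical_range (KMS_matrix n a)))) /\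
  (contains_elliptic_arc (boundary (numerical_range (KMS_matrix n a))) <->
   n = 2%N /\ a != 0).
Proof.
have disc : n = 2%N /\ a != 0 ->
    is_circular_disc (numerical_range (KMS_matrix n a)).
  by move=> [-> a0]; apply: KMS2_disc.
split; split.
- exact: disc_boundary_arc.
- by move=> /KMS_arc_order2.
- exact: KMS_arc_order2.
- by move=> /disc; apply: disc_boundary_arc.
Qed.
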